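(* Let $K\in\mathcal{S}_0$ and let $B_K$ be the origin-symmetric Euclidean ball in $\mathbb{R}^n$ with $|B_K|=|K|$. For $\phi:(0,\infty)\to(0,\infty)$ write $F(t)=\phi(t^{-1/n})$, $t>0$. (i) If $\phi\in\Phi$, then $\widetilde{\omega}_{\phi}(K)\ge\widetilde{\omega}_{\phi}(B_K)$. If in addition $F$ is strictly convex, equality holds if and only if $K$ is an origin-symmetric Euclidean ball. (ii) If $\phi\in\Psi$, then $\widetilde{\omega}_{\phi}(K)\le\widetilde{\omega}_{\phi}(B_K)$. If in addition $F$ is strictly concave, equality holds if and only if $K$ is an origin-symmetric Euclidean ball.
   Context: Fix a positive integer $n$. A star body (about the origin) is a set $K\subset\mathbb{R}^n$ that contains the segment from the origin to each of its points and whose radial function $\rho_K(u)=\max\{\lambda:\lambda u\in K\}$, $u\in S^{n-1}$, is continuous and positive on $S^{n-1}$. $\mathcal{S}_0$ is the set of all star bodies. $|K|$ denotes volume, $\sigma$ is the spherical measure on the unit sphere $S^{n-1}$, $B^n_2$ is the closed unit Euclidean ball in $\mathbb{R}^n$ and $\omega_n=|B^n_2|$. An origin-symmetric Euclidean ball is a set $rB^n_2$ with $r>0$. $\Phi$ is the set of functions $\phi:(0,\infty)\to(0,\infty)$ such that $F(t)=\phi(t^{-1/n})$ is either a constant or a convex function on $(0,\infty)$. $\Psi$ is the set of functions $\phi:(0,\infty)\to(0,\infty)$ such that $F(t)=\phi(t^{-1/n})$ is either a constant or an increasing concave function on $(0,\infty)$. (Such $\phi$ are automatically continuous.) For a continuous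 function $\phi:(0,\infty)\to(0,\infty)$ and $K\in\mathcal{S}_0$, the Orlicz $L_\phi$-harmonic mean radius of $K$ is $$\widetilde{\omega}_{\phi}(K)=\frac{1}{n\omega_n}\int_{S^{n-1}}\phi\bigg(\frac{1}{\rho_K(u)}\bigg)\,d\sigma(u).$$ *)

(* Defs.v *)
From HB Require Import structures.
From mathcomp Require Import all_boot all_order all_algebra.
From mathcomp Require Import all_classical all_reals all_analysis.
From mathcomp Require Import measurable_realfun.

Set Implicit Arguments.
Unset Strict Implicit.
Unset Printing Implicit Defensive.

Import Order.TTheory GRing.Theory Num.Theory.
Import numFieldNormedType.Exports.

Local Open Scope classical_set_scope.
Local Open Scope ring_scope.

Definition rV_display : measure_display. Proof. exact. Qed.

(* The sigma-algebra generated by the coordinates, i.e. the Borel sets of R^n. *)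
Section rV_measurable.
Context {R : realType} (n : nat).

Let coors : 'I_n -> 'rV[R]_n -> measurableTypeR R := fun i v => v ord0 i.

Let rV_set0 : g_sigma_preimage coors set0.
Proof. exact: sigma_algebra0. Qed.

Let rV_setC A : g_sigma_preimage coors A -> g_sigma_preimage coors (~` A).
Proof. exact: sigma_algebraC. Qed.

Let rV_bigcup (F : (set 'rV[R]_n)^nat) :
  (forall i, g_sigma_preimage coors (F i)) ->
  g_sigma_preimage coors (\bigcup_i (F i)).
Proof. exact: sigma_algebra_bigcup. Qed.

HB.instance Definition _ := @isMeasurable.Build rV_display
  'rV[R]_n (g_sigma_preimage coors) rV_set0 rV_setC rV_bigcup.

Lemma measurable_coord i :
  measurable_fun [set: 'rV[R]_n] (fun v => v ord0 i : measurableTypeR R).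
Proof.
move=> _ Y mY; rewrite setTI; apply: sub_sigma_algebra => /=.
rewrite -bigcup_seq/=; exists i => /=; first by rewrite mem_index_enum.
by exists Y => //; rewrite setTI.
Qed.

Lemma measurable_fun_rVP d (T : measurableType d) (f : T -> 'rV[R]_n) :
  (forall i, measurable_fun [set: T] (fun x => f x ord0 i : measurableTypeR R)) ->
  measurable_fun [set: T] f.
Proof.
move=> mf; suff prefS : g_sigma_preimage (fun i => coors i \o f) `<=` measurable.
  rewrite g_sigma_preimage_comp in prefS.
  by move=> _ A mA; apply: prefS; exists A.
apply: smallest_sub; first exact: sigma_algebra_measurable.
rewrite -bigcup_seq; apply: bigcup_sub => i _.
by move=> A [B mB <-]; exact: mf.
Qed.

End rV_measurable.

Definition rV_cons {R : realType} (n : nat) (p : measurableTypeR R * 'rV[R]_n) :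
  'rV[R]_n.+1 :=
  \row_i oapp (fun j => p.2 ord0 j) p.1 (unlift ord0 i).

(* Lebesgue measure on the Borel sets of R^n: the n-fold product of the
   Lebesgue measure on the line. *)
Fixpoint lebesgue_rV {R : realType} (n : nat) : set 'rV[R]_n -> \bar R :=
  if n isn't m.+1 then \d_(0 : 'rV[R]_0) else
  pushforward (lebesgue_measure \x @lebesgue_rV R m)%E (@rV_cons R m).

Section lebesgue_rV_measure.
Context {R : realType}.

Let rV_cons0 n (p : measurableTypeR R * 'rV[R]_n) : rV_cons p ord0 ord0 = p.1.
Proof.
by rewrite mxE unlift_none.
Qed.

Let rV_consS n (p : measurableTypeR R * 'rV[R]_n) i :
  rV_cons p ord0 (lift ord0 i) = p.2 ord0 i.
Proof.
by rewrite mxE liftK.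
Qed.

Lemma measurable_rV_cons n : measurable_fun [set: _] (@rV_cons R n).
Proof.
apply: measurable_fun_rVP => i; case: (unliftP ord0 i) => [j ->|->].
  rewrite (_ : (fun x => _) = (fun v : 'rV[R]_n => v ord0 j : measurableTypeR R) \o snd).
    by apply: measurableT_comp => //; exact: measurable_coord.
  by apply/funext => p /=; rewrite rV_consS.
rewrite (_ : (fun x => _) = fst) //.
by apply/funext => p /=; rewrite rV_cons0.
Qed.

Let uncons n (v : 'rV[R]_n.+1) : measurableTypeR R * 'rV[R]_n :=
  (v ord0 ord0, \row_i v ord0 (lift ord0 i)).

Let unconsK n : cancel (@uncons n) (@rV_cons R n).
Proof.
move=> v; apply/rowP => i; case: (unliftP ord0 i) => [j ->|->].
  by rewrite rV_consS mxE.
by rewrite rV_cons0.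
Qed.

Let rV_consK n : cancel (@rV_cons R n) (@uncons n).
Proof.
move=> [x v]; rewrite /uncons rV_cons0/=; congr (_, _).
by apply/rowP => i; rewrite mxE rV_consS.
Qed.

Let measurable_uncons n : measurable_fun [set: _] (@uncons n).
Proof.
apply/measurable_fun_pairP; split; first exact: measurable_coord.
apply: measurable_fun_rVP => i.
rewrite (_ : (fun x => _) =
    (fun v : 'rV[R]_n.+1 => v ord0 (lift ord0 i) : measurableTypeR R)).
  exact: measurable_coord.
by apply/funext => v /=; rewrite mxE.
Qed.

Let lebesgue_rV_sigma_finite n :
  exists m : {sigma_finite_measure set 'rV[R]_n -> \bar R},
    @lebesgue_rV R n = m :> (set _ -> _).
Proof.
elim: n => [|n [m IH]]; first by exists \d_(0 : 'rV[R]_0).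
pose mu0 : {measure set 'rV[R]_n.+1 -> \bar R} :=
  pushforward (lebesgue_measure \x m)%E (@rV_cons R n).
pose mu := mu0 (@measurable_rV_cons n).
suff sf : sigma_finite setT mu.
  pose sm := Measure_isSigmaFinite.Build _ _ _ mu sf.
  pose smu : {sigma_finite_measure set 'rV[R]_n.+1 -> \bar R} :=
    HB.pack (mu : set _ -> _) (Measure.class mu) sm.
  by exists smu; rewrite /= IH.
have [F FT Foo] : sigma_finite setT (lebesgue_measure \x m)%E.
  have /sigma_finiteP[F [TF ndF Foo]] := sigma_finiteT (@lebesgue_measure R).
  have /sigma_finiteP[G [TG ndG Goo]] := sigma_finiteT m.
  exists (fun n => F n `*` G n).
    rewrite -setXTT TF TG predeqE => -[x y]; split.
      move=> [/= [i _ Fnx] [k _ Gky]]; exists (maxn i k) => //; split.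
      - by move: x Fnx; exact/subsetPset/ndF/leq_maxl.
      - by move: y Gky; exact/subsetPset/ndG/leq_maxr.
    by move=> [i _ []/= ? ?]; split; exists i.
  move=> k; have [? ?] := Foo k; have [? ?] := Goo k.
  split; first exact: measurableX.
  by rewrite product_measure1E// lte_mul_pinfty// ge0_fin_numE.
exists (fun k => @uncons n @^-1` F k).
  by rewrite -preimage_bigcup -FT preimage_setT.
move=> k; have [mF Fk] := Foo k; split.
  by rewrite -[X in measurable X]setTI; exact: measurable_uncons.
rewrite /mu/= /pushforward -comp_preimage.
by rewrite (_ : _ \o _ = id) ?preimage_id//; apply/funext => p /=; rewrite rV_consK.
Qed.

Context (n : nat).

Let lebesgue_rV0 : @lebesgue_rV R n set0 = 0%E.
Proof. by have [m ->] := lebesgue_rV_sigma_finite n; rewrite measure0. Qed.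

Let lebesgue_rV_ge0 A : (0 <= @lebesgue_rV R n A)%E.
Proof. by have [m ->] := lebesgue_rV_sigma_finite n; exact: measure_ge0. Qed.

Let lebesgue_rV_sigma_additive : semi_sigma_additive (@lebesgue_rV R n).
Proof.
by have [m ->] := lebesgue_rV_sigma_finite n; exact: measure_semi_sigma_additive.
Qed.

HB.instance Definition _ := isMeasure.Build _ _ _ (@lebesgue_rV R n)
  lebesgue_rV0 lebesgue_rV_ge0 lebesgue_rV_sigma_additive.

Let lebesgue_rV_sfT : sigma_finite setT (@lebesgue_rV R n).
Proof. by have [m ->] := lebesgue_rV_sigma_finite n; exact: sigma_finiteT. Qed.

HB.instance Definition _ := Measure_isSigmaFinite.Build _ _ _
  (@lebesgue_rV R n) lebesgue_rV_sfT.

End lebesgue_rV_measure.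

(* The canonical norm on 'rV[R]_n is the sup norm, hence a separate definition. *)
Definition enorm {R : realType} {n : nat} (x : 'rV[R]_n) : R :=
  Num.sqrt (\sum_i x ord0 i ^+ 2).

Definition unit_ball (R : realType) (n : nat) : set 'rV[R]_n :=
  [set x | enorm x <= 1].
Arguments unit_ball : clear implicits.

Definition unit_sphere (R : realType) (n : nat) : set 'rV[R]_n :=
  [set u | enorm u = 1].
Arguments unit_sphere : clear implicits.

Definition sphere_cone {R : realType} {n : nat} (A : set 'rV[R]_n) :
    set 'rV[R]_n :=
  [set t *: u | t in `]0, 1]%classic & u in A `&` unit_sphere R n].

(* Spherical Lebesgue measure, as a Borel measure on R^n concentrated on the
   sphere: n times the volume of the cone over A, so that
   dx = t^(n-1) dt dsigma(u) in polar coordinates and sigma(S^(n-1)) is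
   n times the volume of the unit ball. *)
Definition sphere_measure {R : realType} (n : nat) (A : set 'rV[R]_n) : \bar R :=
  (n%:R%:E * lebesgue_rV (sphere_cone A))%E.

Section sphere_measure_measure.
Context {R : realType} (n : nat).

Let dir (x : 'rV[R]_n) : 'rV[R]_n := (enorm x)^-1 *: x.

Let enormE (x : 'rV[R]_n) : enorm x = (\sum_i x ord0 i ^+ 2) `^ 2^-1.
Proof. by rewrite powR12_sqrt// sumr_ge0// => i _; exact: sqr_ge0. Qed.

Lemma measurable_enorm : measurable_fun [set: 'rV[R]_n] (enorm : _ -> measurableTypeR R).
Proof.
rewrite (_ : enorm = (@powR R ^~ 2^-1) \o (fun x => \sum_i x ord0 i ^+ 2)).
  apply: (measurableT_comp (measurable_powR 2^-1)).
  apply: measurable_sum => i; apply: measurable_funX.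
  exact: measurable_coord.
by apply/funext => x /=; rewrite enormE.
Qed.

Lemma enormZ (t : R) (x : 'rV[R]_n) : enorm (t *: x) = `|t| * enorm x.
Proof.
rewrite /enorm -sqrtr_sqr -sqrtrM ?sqr_ge0// mulr_sumr; congr Num.sqrt.
by apply: eq_bigr => i _; rewrite mxE exprMn.
Qed.

Let measurable_dir : measurable_fun [set: 'rV[R]_n] dir.
Proof.
apply: measurable_fun_rVP => i.
rewrite (_ : (fun x => _) = (fun x : 'rV[R]_n => (enorm x) `^ (-1) * x ord0 i)).
  apply: measurable_funM; last exact: measurable_coord.
  apply: (measurableT_comp (measurable_powR (-1))).
  exact: measurable_enorm.
by apply/funext => x /=; rewrite mxE powR_inv1// sqrtr_ge0.
Qed.

Let D : set 'rV[R]_n := enorm @^-1` `]0, 1]%classic.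

Let mD : measurable D.
Proof. by rewrite -[X in measurable X]setTI; exact: measurable_enorm. Qed.

Let sphere_measureE : exists m : {measure set 'rV[R]_n -> \bar R},
  @sphere_measure R n = m :> (set _ -> _).
Proof.
pose m0 : {measure set 'rV[R]_n -> \bar R} := mrestr (@lebesgue_rV R n) mD.
pose m1 : {measure set 'rV[R]_n -> \bar R} := pushforward m0 dir.
exists (mscale n%:R%:nng (m1 measurable_dir)).
apply/funext => A; rewrite /sphere_measure /mscale/=; congr (_ * _)%E.
rewrite /pushforward /m0/= /mrestr; congr lebesgue_rV.
apply/seteqP; split=> [_ [t /= + [u [Au u1] <-]]|x [/= Ax]].
  rewrite in_itv/= => /andP[t0 t1]; rewrite /unit_sphere/= in u1.
  rewrite /D/= /dir enormZ u1 mulr1 gtr0_norm// scalerA mulVf ?gt_eqF// scale1r.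
  by split => //=; rewrite in_itv/= t0.
rewrite /D/= in_itv/= => /andP[x0 x1].
exists (enorm x); rewrite /= ?in_itv/= ?x0//; exists (dir x).
  by split=> //; rewrite /unit_sphere/= /dir enormZ gtr0_norm ?invr_gt0// mulVf// gt_eqF.
by rewrite /dir scalerA divff ?scale1r// gt_eqF.
Qed.

Let sphere_measure0 : @sphere_measure R n set0 = 0%E.
Proof. by have [m ->] := sphere_measureE; rewrite measure0. Qed.

Let sphere_measure_ge0 A : (0 <= @sphere_measure R n A)%E.
Proof. by have [m ->] := sphere_measureE; exact: measure_ge0. Qed.

Let sphere_measure_sigma_additive : semi_sigma_additive (@sphere_measure R n).
Proof.
by have [m ->] := sphere_measureE; exact: measure_semi_sigma_additive.
Qed.

HB.instance Definition _ := isMeasure.Build _ _ _ (@sphere_measure R n)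
  sphere_measure0 sphere_measure_ge0 sphere_measure_sigma_additive.

End sphere_measure_measure.

Section orlicz.
Context {R : realType} {n : nat}.
Implicit Types (K : set 'rV[R]_n) (phi : R -> R).

Definition radial K (u : 'rV[R]_n) : R := sup [set l | K (l *: u)].

(* The second clause makes the supremum defining rho_K(u) a maximum. *)
Definition star_body K :=
  [/\ (forall x t, K x -> 0 <= t <= 1 -> K (t *: x)),
      (forall u, unit_sphere R n u ->
         K (radial K u *: u) /\ forall l, K (l *: u) -> l <= radial K u),
      {within unit_sphere R n, continuous (radial K)} &
      forall u, unit_sphere R n u -> 0 < radial K u].

Definition origin_ball K :=
  exists2 r : R, 0 < r & K = [set r *: x | x in unit_ball R n].

Definition orlicz_radius phi K : R :=
  (n%:R * fine (lebesgue_rV (unit_ball R n)))^-1 *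
  \int[@sphere_measure R n]_(u in unit_sphere R n) phi ((radial K u)^-1).

End orlicz.

Section function_classes.
Context {R : realType}.
Implicit Types (n : nat) (f phi : R -> R).

Definition pos_line : set R := [set t | 0 < t].

Definition convex_on_pos f := @convex_function R R^o pos_line f.

Definition concave_on_pos f := convex_on_pos (\- f).

Definition strictly_convex_on_pos f :=
  forall t x y : R, 0 < t < 1 -> 0 < x -> 0 < y -> x != y ->
    f (t * x + (1 - t) * y) < t * f x + (1 - t) * f y.

Definition strictly_concave_on_pos f := strictly_convex_on_pos (\- f).

Definition substF n phi : R -> R := fun t => phi (t `^ (- n%:R^-1)).

Definition class_Phi n phi :=
  (forall t, 0 < t -> 0 < phi t) /\
  ((exists c, forall t, 0 < t -> substF n phi t = c) \/
   convex_on_pos (substF n phi)).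

(* "Increasing" is read in the wide sense. *)
Definition class_Psi n phi :=
  (forall t, 0 < t -> 0 < phi t) /\
  ((exists c, forall t, 0 < t -> substF n phi t = c) \/
   {in pos_line &, nondecreasing_fun (substF n phi)} /\
   concave_on_pos (substF n phi)).

End function_classes.

(* Main.v *)
Require Import Defs.
From HB Require Import structures.
From mathcomp Require Import all_boot all_order all_algebra.
From mathcomp Require Import all_classical all_reals all_analysis.
From mathcomp Require Import measurable_realfun.
From mathcomp Require Import ring lra.

                                                                                
                                                                               
                                                                               
                                                                          
                                                                           
                                                                               
                                                                                 
                                                                               

(** Write F(t) = phi(t^(-1/n)), rho for the radial function of K, and w for n times the volume of
    the unit ball, which is the total mass of the sphere. Since phi(1/rho) = F(rho^n), the Orlicz
    radius of K is the mean of F(rho^n) over the sphere ([orlicz_radius_substF]), and that of the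
    ball of radius r is F(r^n) ([orlicz_radius_ball]). Polar coordinates turn n|K| into the integral
    of rho^n ([polar_volume], [lebesgue_star_body]), so equality of volumes says that rho^n has mean
    r^n ([Rintegral_radialX]).

    The convex case is therefore Jensen's inequality. Let c be the slope of a supporting line of F
    at s = r^n ([convex_on_pos_support]). Then g = F(rho^n) - F(s) - c(rho^n - s) is nonnegative,
    and its integral is w times the difference of the two Orlicz radii ([orlicz_radius_gap]). If
    they are equal, g vanishes almost everywhere; under strict convexity the line touches the graph
    only at s, so rho = r almost everywhere. This holds everywhere because rho is continuous and
    nonempty relatively open subsets of the sphere have positive measure
    ([eq_on_sphere_of_negligible]). The concave case is the convex one applied to -phi.

    The polar formula comes from the definition of the spherical measure by cones: for a constant
    radius it is the scaling law [lebesgue_rV_preimageZ], and a general radius is squeezed between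
    constants on small pieces of the sphere. *)

Import Order.TTheory GRing.Theory Num.Theory.
Import numFieldNormedType.Exports.

Local Open Scope classical_set_scope.
Local Open Scope ring_scope.

                                        

(** * Lebesgue measure on R^n: scaling, boxes, open sets *)

Section lebesgue_rV_theory.
Context {R : realType}.
Implicit Types (n : nat) (t : R).

(** By uniqueness of Lebesgue measure: the left side is a measure in A that gives half-open
    intervals their length. *)
Lemma lebesgue_measure_preimageM t (A : set (measurableTypeR R)) :
  0 < t -> measurable A ->
  (t%:E * lebesgue_measure (( *%R t : _ -> measurableTypeR R) @^-1` A)
   = lebesgue_measure A)%E.
Proof.
move=> t0 mA; set f : measurableTypeR R -> measurableTypeR R := *%R t.
have mf : measurable_fun [set: measurableTypeR R] f by exact: mulrl_measurable.
pose m0 : {measure set (measurableTypeR R) -> \bar R} :=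
  pushforward lebesgue_measure f.
pose m1 : {measure set (measurableTypeR R) -> \bar R} :=
  mscale (NngNum (ltW t0)) (m0 mf).
rewrite -[LHS]/(m1 A).
apply/esym/lebesgue_measure_unique => //= _ [[a b]] _ <-.
rewrite /m1 /m0/= /mscale/= /pushforward.
have -> : f @^-1` [set x | x \in `]a, b] ] = `]t^-1 * a, t^-1 * b]%classic.
  apply/seteqP; split => x /=; rewrite !in_itv/= /f => /andP[? ?];
    apply/andP; split.
  - by rewrite ltr_pdivrMl.
  - by rewrite ler_pdivlMl.
  - by rewrite -ltr_pdivrMl.
  - by rewrite -ler_pdivlMl.
rewrite !lebesgue_measure_itv/= !lte_fin ltr_pM2l ?invr_gt0//.
case: ifPn => ab; last by rewrite mule0.
by rewrite -!EFinD -EFinM; congr EFin; field; rewrite gt_eqF.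
Qed.

Lemma rV_cons0 n (p : measurableTypeR R * 'rV[R]_n) : rV_cons p ord0 ord0 = p.1.
Proof. by rewrite mxE unlift_none. Qed.

Lemma rV_consS n (p : measurableTypeR R * 'rV[R]_n) i :
  rV_cons p ord0 (lift ord0 i) = p.2 ord0 i.
Proof. by rewrite mxE liftK. Qed.

Lemma rV_consZ n t (p : measurableTypeR R * 'rV[R]_n) :
  rV_cons (t * p.1 : measurableTypeR R, t *: p.2) = t *: rV_cons p.
Proof.
apply/rowP => i; rewrite [RHS]mxE; case: (unliftP ord0 i) => [j ->|->].
  by rewrite !rV_consS/= mxE.
by rewrite !rV_cons0.
Qed.

Lemma measurable_scaler n t : measurable_fun [set: 'rV[R]_n] ( *:%R t).
Proof.
apply: measurable_fun_rVP => i.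
rewrite (_ : (fun x => _) = (fun v : 'rV[R]_n => t * v ord0 i)).
  by apply: measurable_funM => //; exact: measurable_coord.
by apply/funext => v; rewrite mxE.
Qed.

(** Induction on the dimension. By uniqueness of the product measure it is enough to compare on
    rectangles, where the first factor contributes t and the second t^n. *)
Lemma lebesgue_rV_preimageZ n t (A : set 'rV[R]_n) : 0 < t -> measurable A ->
  ((t ^+ n)%:E * lebesgue_rV ( *:%R t @^-1` A) = lebesgue_rV A)%E.
Proof.
move=> t0; elim: n A => [|n IH] A mA.
  rewrite expr0 mul1e /= !diracE; congr (_%:R%:E); congr nat_of_bool.
  by apply/idP/idP; rewrite !inE/= scaler0.
pose g (p : measurableTypeR R * 'rV[R]_n) : measurableTypeR R * 'rV[R]_n :=
  (t * p.1, t *: p.2).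
have mg : measurable_fun setT g.
  apply/measurable_fun_pairP; split => /=.
    by apply: measurable_funM.
  by apply: (measurableT_comp (measurable_scaler n t)).
pose m0 : {measure set (measurableTypeR R * 'rV[R]_n) -> \bar R} :=
  pushforward (@lebesgue_measure R \x @lebesgue_rV R n)%E g.
have tn0 : 0 <= t ^+ n.+1 by rewrite exprn_ge0// ltW.
pose m1 : {measure set (measurableTypeR R * 'rV[R]_n) -> \bar R} :=
  mscale (NngNum tn0) (m0 mg).
have mA' : measurable (@rV_cons R n @^-1` A).
  by rewrite -[X in measurable X]setTI; exact: measurable_rV_cons.
rewrite -[RHS]/((@lebesgue_measure R \x @lebesgue_rV R n)%E (@rV_cons R n @^-1` A)).
rewrite (@product_measure_unique _ _ _ _ _ _ _ m1)//.
  have E : @rV_cons R n @^-1` ( *:%R t @^-1` A) = g @^-1` (@rV_cons R n @^-1` A).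
    by apply/seteqP; split => p; rewrite /preimage/= rV_consZ.
  rewrite -[RHS]/((t ^+ n.+1)%:E *
    (@lebesgue_measure R \x @lebesgue_rV R n) (g @^-1` (@rV_cons R n @^-1` A)))%E.
  by rewrite -E.
move=> B C mB mC; rewrite /m1 /m0/= /mscale/= /pushforward.
rewrite -(lebesgue_measure_preimageM t B)// -(IH C)//.
set f : measurableTypeR R -> measurableTypeR R := *%R t.
have mf : measurable_fun [set: measurableTypeR R] f by exact: mulrl_measurable.
have -> : g @^-1` (B `*` C) = (f @^-1` B) `*` ( *:%R t @^-1` C) by [].
rewrite product_measure1E//=; last 2 first.
- by rewrite -[X in measurable X]setTI; exact: mf.
- by rewrite -[X in measurable X]setTI; exact: measurable_scaler.
by rewrite exprS EFinM muleACA.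
Qed.

Lemma measurable_rV_box n (A : 'I_n -> set (measurableTypeR R)) :
  (forall i, measurable (A i)) ->
  measurable [set v : 'rV[R]_n | forall i, A i (v ord0 i)].
Proof.
move=> mA; rewrite [X in measurable X](_ : _ = \bigcap_i
    ((fun v : 'rV[R]_n => v ord0 i : measurableTypeR R) @^-1` A i)).
  apply: fin_bigcap_measurable => [|i _]; first exact: finite_finset.
  by rewrite -[X in measurable X]setTI; exact: measurable_coord.
by apply/seteqP; split => [v vA i _|v vA i]; exact: vA.
Qed.

Lemma lebesgue_rV_box n (A : 'I_n -> set (measurableTypeR R)) :
  (forall i, measurable (A i)) ->
  lebesgue_rV [set v : 'rV[R]_n | forall i, A i (v ord0 i)] =
  (\prod_(i < n) lebesgue_measure (A i))%E.
Proof.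
elim: n A => [|n IH] A mA.
  by rewrite big_ord0 /= diracE mem_set//= => -[].
rewrite big_ord_recl -IH//.
rewrite -(product_measure1E (@lebesgue_measure R) (@lebesgue_rV R n))//; last first.
  exact: (measurable_rV_box n (fun i => A (lift ord0 i))).
set B := [set v | _]; set C := [set v | _].
suff -> : A ord0 `*` C = @rV_cons R n @^-1` B by [].
apply/seteqP; split => [[x v] /= [x0 v0] i|[x v] /= xv].
  by case: (unliftP ord0 i) => [j ->|->]; rewrite ?rV_cons0 ?rV_consS//; exact: v0.
split => /= [|i]; first by have := xv ord0; rewrite rV_cons0.
by have := xv (lift ord0 i); rewrite rV_consS.
Qed.

Lemma lebesgue_rV_ball n (x : 'rV[R]_n) e : 0 < e ->
  lebesgue_rV (ball x e) = ((e *+ 2) ^+ n)%:E.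
Proof.
move=> e0.
rewrite [X in lebesgue_rV X](_ : _ = [set v : 'rV[R]_n | forall i,
    (ball (x ord0 i) e : set (measurableTypeR R)) (v ord0 i)]); last first.
  apply/seteqP; split => [v [_ +] i|v vx]; first exact.
  by split => // i j; rewrite (ord1 i).
rewrite (lebesgue_rV_box n (fun i => ball (x ord0 i) e)); last first.
  by move=> i; exact: measurable_ball.
under eq_bigr do rewrite lebesgue_measure_ball ?ltW//.
by rewrite prodEFin prodr_const card_ord.
Qed.

(** The sigma-algebra is generated by the coordinates, so this links it to the topology: U is the
    union of the countably many rational cubes that it contains. *)
Lemma open_rV_measurable n (U : set 'rV[R]_n) : open U -> measurable U.
Proof.
move=> oU.
pose B (c : 'rV[rat]_n * nat) := [set v : 'rV[R]_n | forall i,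
  (ball (ratr (c.1 ord0 i) : R) c.2.+1%:R^-1 : set (measurableTypeR R)) (v ord0 i)].
rewrite [X in measurable X](_ : _ =
    \bigcup_c (if `[< B c `<=` U >] then B c else set0)).
  apply: countable_bigcupT_measurable => [|c]; first exact: countableP.
  case: ifPn => // _.
  apply: (measurable_rV_box n (fun i => ball (ratr (c.1 ord0 i) : R) c.2.+1%:R^-1)).
  by move=> i; exact: measurable_ball.
apply/seteqP; split => [x Ux|x [c _]]; last by case: asboolP => // + Bx; exact.
have /nbhs_ballP[e /= e0 xeU] : nbhs x U by exact: open_nbhs_nbhs.
(* A cube of half-side 1/(k+1) < e/2 whose centre is within 1/(k+1) of x contains x and stays inside
   the e-ball. *)
have [k ke] : exists k : nat, k.+1%:R^-1 < e / 2.
  have e20 : 0 < e / 2 by rewrite divr_gt0.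
  have [k _ /(_ k)] := near_infty_natSinv_lt (PosNum e20).
  by move=> /(_ (leqnn k)) ?; exists k.
have k0 : 0 < (k.+1%:R^-1 : R) by rewrite invr_gt0.
have /choice[c xc] i : exists q : rat,
    ball (x ord0 i) k.+1%:R^-1 (ratr q).
  have [q] := @rat_in_itvoo R (x ord0 i - k.+1%:R^-1) (x ord0 i + k.+1%:R^-1)
    ltac:(by rewrite ltrD2l gtrN).
  by exists q; rewrite ball_itv.
have xB : B (\row_i c i, k) x by move=> i /=; rewrite mxE; exact/ball_sym.
exists (\row_i c i, k) => //; case: asboolP => // -[] v vB; apply: xeU.
split => // a i; rewrite (ord1 a) [e]splitr.
have /ltW/le_ball/(_ _ (xc i)) cx := ke.
have := vB i; rewrite /= mxE => /(le_ball (ltW ke)).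
exact: ball_triangle cx.
Qed.

End lebesgue_rV_theory.

                                      

(** * Euclidean norm, radial projection, unit sphere and unit ball *)

Section euclidean_norm.
Context {R : realType} {n : nat}.
Implicit Types (x u : 'rV[R]_n) (t : R).

Lemma enorm_ge0 x : 0 <= enorm x.
Proof. exact: sqrtr_ge0. Qed.

Lemma enorm0 : enorm (0 : 'rV[R]_n) = 0.
Proof. by rewrite -[0](scale0r 0) enormZ normr0 mul0r. Qed.

Lemma ler_coord_enorm x i : `|x ord0 i| <= enorm x.
Proof.
rewrite -sqrtr_sqr ler_wsqrtr// (bigD1 i)//= lerDl.
by apply: sumr_ge0 => j _; exact: sqr_ge0.
Qed.

Lemma enorm_gt0 x : (0 < enorm x) = (x != 0).
Proof.
rewrite lt_def enorm_ge0 andbT; congr negb; apply/eqP/eqP => [x0|->].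
  apply/rowP => i; rewrite mxE; apply/eqP.
  by rewrite -normr_le0 -x0; exact: ler_coord_enorm.
exact: enorm0.
Qed.

Lemma enorm_continuous : continuous (@enorm R n).
Proof.
move=> x; rewrite /enorm.
apply: (@continuous_comp _ _ _ (fun x : 'rV[R]_n => \sum_i x ord0 i ^+ 2)); last first.
  exact: sqrt_continuous.
apply: (@continuous_big R _ +%R 0 _ (@add_continuous R) _ _
  (fun i (x : 'rV[R]_n) => x ord0 i ^+ 2)).
move=> i _ y; apply: (@continuous_comp _ _ _ (fun x : 'rV[R]_n => x ord0 i)
  (fun y : R => y ^+ 2)).
  exact: coord_continuous.
exact: exprn_continuous.
Qed.

(** Radial projection onto the sphere. It sends 0 to 0, because 0^-1 = 0, so [enorm_direction] holds
    at the origin too. *)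
Definition direction x := (enorm x)^-1 *: x.

Lemma measurable_direction : measurable_fun [set: 'rV[R]_n] direction.
Proof.
apply: measurable_fun_rVP => i.
rewrite (_ : (fun x => _) = (fun x : 'rV[R]_n => (enorm x) `^ (-1) * x ord0 i)).
  apply: measurable_funM; last exact: measurable_coord.
  apply: (measurableT_comp (measurable_powR (-1))).
  exact: measurable_enorm.
by apply/funext => x /=; rewrite mxE powR_inv1// enorm_ge0.
Qed.

Lemma direction_sphere x : 0 < enorm x -> unit_sphere R n (direction x).
Proof.
by move=> x0; rewrite /unit_sphere/= enormZ gtr0_norm ?invr_gt0// mulVf ?gt_eqF.
Qed.

Lemma enorm_direction x : enorm x *: direction x = x.
Proof.
have [->|x0] := eqVneq x 0; first by rewrite /direction !scaler0.
by rewrite /direction scalerA divff ?scale1r// gt_eqF// enorm_gt0.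
Qed.

Lemma directionZ t x : 0 < t -> direction (t *: x) = direction x.
Proof.
move=> t0; rewrite /direction enormZ gtr0_norm// scalerA invfM mulrAC.
by rewrite mulVf ?mul1r// gt_eqF.
Qed.

Lemma direction_id u : unit_sphere R n u -> direction u = u.
Proof. by rewrite /unit_sphere/= /direction => ->; rewrite invr1 scale1r. Qed.

Lemma direction_continuous x : x != 0 -> {for x, continuous direction}.
Proof.
move=> x0; have e0 : enorm x != 0 by rewrite gt_eqF// enorm_gt0.
have h : {for x, continuous (fun y : 'rV[R]_n => (enorm y)^-1)}.
  apply: (@continuous_comp _ _ _ (@enorm R n) (@GRing.inv R)).
    exact: enorm_continuous.
  exact: inv_continuous.
exact: (cvgZ h cvg_id).
Qed.

Lemma unit_sphere_compact : compact (unit_sphere R n).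
Proof.
apply: bounded_closed_compact.
  exists 1; split => // M M1 u u1; rewrite /Num.norm/= mx_normrE.
  apply/bigmax_leP; split; first by rewrite ltW// (lt_trans ltr01).
  move=> [a i] _ /=; rewrite (ord1 a) (le_trans (ler_coord_enorm _ _))//.
  by rewrite u1 ltW.
have -> : unit_sphere R n = enorm @^-1` [set 1] by [].
apply: closed_comp => [x _|]; first exact: enorm_continuous.
exact: closed_eq.
Qed.

Lemma measurable_unit_sphere : measurable (unit_sphere R n).
Proof.
rewrite -[X in measurable X]setTI.
have /(_ measurableT [set 1]) := @measurable_enorm R n.
by apply; exact: measurable_set1.
Qed.

Lemma measurable_unit_ball : measurable (unit_ball R n).
Proof.
rewrite (_ : unit_ball R n = enorm @^-1` `]-oo, 1]%classic); last first.
  by apply/seteqP; split => x; rewrite /unit_ball/= in_itv.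
by rewrite -[X in measurable X]setTI; exact: measurable_enorm.
Qed.

Lemma unit_sphere_neq0 : (0 < n)%N -> unit_sphere R n !=set0.
Proof.
case: n => // m _; exists (delta_mx ord0 ord0).
rewrite /unit_sphere/= /enorm big_ord_recl mxE eqxx expr1n big1 ?addr0 ?sqrtr1//.
by move=> i _; rewrite mxE /= expr0n.
Qed.

(** The preimage of an open interval is the trace on the sphere of an open set of R^n, which is
    measurable by [open_rV_measurable]. *)
Lemma sphere_continuous_measurable (f : 'rV[R]_n -> R) :
  {within unit_sphere R n, continuous f} ->
  measurable_fun (unit_sphere R n) (f : _ -> measurableTypeR R).
Proof.
move=> /continuousP cf mS.
apply: (measurability _ (RGenOpens.measurableE R)) => //.
move=> _ [_ [a [b ->] <-]].
have /open_subspaceP[V oV VD] := cf _ (@interval_open R (BRight a) (BLeft b) isT isT).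
rewrite setIC -VD; apply: measurableI; [exact: open_rV_measurable|exact: mS].

Qed.

Lemma lebesgue_rV_origin : (0 < n)%N -> lebesgue_rV [set (0 : 'rV[R]_n)] = 0%E.
Proof.
case: n => // m _.
rewrite (_ : [set 0] = [set v : 'rV[R]_m.+1 | forall i,
    [set (0 : measurableTypeR R)] (v ord0 i)]); last first.
  apply/seteqP; split => [_ -> i|v v0]; first by rewrite mxE.
  by apply/rowP => i; rewrite mxE; exact: v0.
rewrite (lebesgue_rV_box m.+1 (fun=> [set 0]))//.
by rewrite big_ord_recl lebesgue_measure_set1 mul0e.
Qed.

Lemma lebesgue_unit_ball_lty : (lebesgue_rV (unit_ball R n) < +oo)%E.
Proof.
apply: (@le_lt_trans _ _ (lebesgue_rV (ball (0 : 'rV[R]_n) 2))); last first.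
  by rewrite lebesgue_rV_ball// ltry.
apply: le_measure; rewrite ?inE.
- exact: measurable_unit_ball.
- by apply: open_rV_measurable; exact: ball_open.
- move=> x x1; split => // a i; rewrite (ord1 a) mxE /ball/= sub0r normrN.
  apply: le_lt_trans (ler_coord_enorm _ _) _; apply: le_lt_trans x1 _.
  by rewrite ltr1n.
Qed.

(** U contains a ball of the sup norm, that is, a cube, whose volume is explicit. *)
Lemma open_lebesgue_rV_gt0 (U : set 'rV[R]_n) x :
  open U -> U x -> (0 < lebesgue_rV U)%E.
Proof.
move=> oU Ux.
have /nbhs_ballP[e /= e0 xeU] : nbhs x U by exact: open_nbhs_nbhs.
apply: (@lt_le_trans _ _ (lebesgue_rV (ball x e))).
  by rewrite lebesgue_rV_ball// lte_fin exprn_gt0// mulrn_wgt0.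
apply: le_measure; rewrite ?inE//.
- by apply: open_rV_measurable; exact: ball_open.
- exact: open_rV_measurable.
Qed.

Lemma lebesgue_unit_ball_gt0 : (0 < lebesgue_rV (unit_ball R n))%E.
Proof.
pose U := [set x : 'rV[R]_n | enorm x < 1].
have oU : open U.
  apply: (@open_comp _ _ enorm [set y | y < 1]) => [x _|].
    exact: enorm_continuous.
  exact: open_lt.
apply: (@lt_le_trans _ _ (lebesgue_rV U)).
  by apply: (@open_lebesgue_rV_gt0 U 0) => //; rewrite /U/= enorm0.
apply: le_measure; rewrite ?inE//.
- exact: open_rV_measurable.
- exact: measurable_unit_ball.
- by move=> x; rewrite /U /unit_ball/= => /ltW.
Qed.

End euclidean_norm.

                                    

(** * Volume in polar coordinates *)

Section polar_coordinates.
Context {R : realType} {n : nat}.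
Implicit Types (r : 'rV[R]_n -> R) (A : set 'rV[R]_n) (s t q : R).

(** The star-shaped set with radial function r, without the origin, which has no direction on the
    sphere. *)
Definition star_set r : set 'rV[R]_n :=
  [set x | 0 < enorm x <= r (direction x)].

Lemma measurable_star_set r :
  measurable_fun (unit_sphere R n) (r : _ -> measurableTypeR R) ->
  measurable (star_set r).
Proof.
move=> mr; pose D : set 'rV[R]_n := enorm @^-1` `]0, +oo[%classic.
have DE x : D x = (0 < enorm x) by rewrite /D/= in_itv/= andbT.
have mD : measurable D by rewrite -[X in measurable X]setTI; exact: measurable_enorm.
have mrd : measurable_fun D (r \o direction : _ -> measurableTypeR R).
  apply: (measurable_comp measurable_unit_sphere _ mr).
    by move=> _ [x + <-]; rewrite DE; exact: direction_sphere.
  exact: measurable_funTS measurable_direction.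
have me : measurable_fun D (enorm : _ -> measurableTypeR R).
  exact: measurable_funTS (@measurable_enorm R n).
have mt : measurable [set true] by [].
have := measurable_fun_ler me mrd mD mt.
congr measurable; apply/seteqP; split => x; rewrite /star_set/=.
  by move=> [+ h]; rewrite DE => ->; rewrite h.
by move=> /andP[x0 ->]; split => //; rewrite DE.
Qed.

Lemma sphere_coneE A :
  sphere_cone A = star_set (cst 1) `&` direction @^-1` A.
Proof.
apply/seteqP; split => [_ [t /= + [u [Au u1] <-]]|x [/= /andP[x0 x1] Ax]].
  rewrite in_itv/= => /andP[t0 t1]; split => /=.
    by rewrite /star_set/= enormZ u1 mulr1 gtr0_norm// t0.
  by rewrite directionZ// direction_id.
exists (enorm x); first by rewrite /= in_itv/= x0.
by exists (direction x); [split => //; exact: direction_sphere|exact: enorm_direction].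
Qed.

Lemma star_set_cst_direction s A : 0 < s -> measurable A ->
  lebesgue_rV (star_set (cst s) `&` direction @^-1` A) =
  ((s ^+ n)%:E * lebesgue_rV (sphere_cone A))%E.
Proof.
move=> s0 mA.
have mB : measurable (star_set (cst s) `&` direction @^-1` A).
  apply: measurableI; first by apply: measurable_star_set; exact: measurable_cst.
  by rewrite -[X in measurable X]setTI; exact: measurable_direction.
rewrite -(lebesgue_rV_preimageZ n s)// sphere_coneE; congr (_ * lebesgue_rV _)%E.
apply/seteqP; split => x /=; rewrite /star_set/= directionZ// enormZ;
  by rewrite gtr0_norm// pmulr_rgt0// ger_pMr.
Qed.

                                                                                
                                   
(** Both X and Y lie between s^n sigma(A) and (q s)^n sigma(A): X by comparing the sector with
    sectors of constant radius, Y by comparing integrands. Hence they agree up to the factor q^n. *)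
Lemma star_set_direction_between r q s A :
    measurable_fun (unit_sphere R n) (r : _ -> measurableTypeR R) ->
    1 <= q -> 0 < s -> measurable A -> A `<=` unit_sphere R n ->
    (forall u, A u -> s <= r u <= q * s) ->
  let X := (n%:R%:E * lebesgue_rV (star_set r `&` direction @^-1` A))%E in
  let Y := (\int[@sphere_measure R n]_(u in A) (r u ^+ n)%:E)%E in
  (X <= (q ^+ n)%:E * Y)%E /\ (Y <= (q ^+ n)%:E * X)%E.
Proof.
move=> mr q1 s0 mA AS rA X Y.
have q0 : 0 < q by apply: lt_le_trans q1.
have qs0 : 0 < q * s by rewrite mulr_gt0.
have mdA : measurable (direction @^-1` A).
  by rewrite -[X in measurable X]setTI; exact: measurable_direction.
have mdr f : measurable_fun (unit_sphere R n) (f : _ -> measurableTypeR R) ->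
    measurable (star_set f `&` direction @^-1` A).
  by move=> mf; apply: measurableI => //; exact: measurable_star_set.
have mrA : measurable_fun A (fun u => (r u ^+ n)%:E).
  apply/measurable_EFinP; apply: measurable_funX.
  exact: measurable_funS measurable_unit_sphere AS mr.
have X1 : ((s ^+ n)%:E * sphere_measure A <= X)%E.
  rewrite /sphere_measure muleCA -star_set_cst_direction//.
  apply: lee_wpmul2l; first by rewrite lee_fin.
  apply: le_measure; rewrite ?inE; [by apply: mdr; exact: measurable_cst|exact: mdr|].
  move=> x [/andP[x0 xs] /= Ax]; split => //=; rewrite /star_set/= x0.
  by apply: (le_trans xs); case/andP: (rA _ Ax).
have X2 : (X <= ((q * s) ^+ n)%:E * sphere_measure A)%E.
  rewrite /sphere_measure muleCA -star_set_cst_direction//.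
  apply: lee_wpmul2l; first by rewrite lee_fin.
  apply: le_measure; rewrite ?inE; [exact: mdr|by apply: mdr; exact: measurable_cst|].
  move=> x [/andP[x0 xs] /= Ax]; split => //=; rewrite /star_set/= x0.
  by apply: (le_trans xs); case/andP: (rA _ Ax).
have Y1 : ((s ^+ n)%:E * sphere_measure A <= Y)%E.
  rewrite -integral_cst//; apply: ge0_le_integral => //=.
  - by move=> u _; rewrite lee_fin exprn_ge0// ltW.
  - move=> u Au; have /andP[su _] := rA u Au.
    by rewrite lee_fin lerXn2r// nnegrE ltW// (lt_le_trans s0).
have Y2 : (Y <= ((q * s) ^+ n)%:E * sphere_measure A)%E.
  rewrite -integral_cst//; apply: ge0_le_integral => //=.
  - move=> u Au; have /andP[su _] := rA u Au.
    by rewrite lee_fin exprn_ge0// ltW// (lt_le_trans s0).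
  - move=> u Au; have /andP[su us] := rA u Au.
    by rewrite lee_fin lerXn2r// nnegrE ltW// (lt_le_trans s0).
have qn0 : (0 <= (q ^+ n)%:E)%E by rewrite lee_fin exprn_ge0// ltW.
split; [apply: (le_trans X2)|apply: (le_trans Y2)];
  by rewrite exprMn EFinM -muleA; apply: lee_wpmul2l.
Qed.

(** The sphere is cut into countably many pieces on which r varies by a factor at most q;
    [star_set_direction_between] is summed over them, and q tends to 1. *)
Lemma polar_volume r a : (0 < n)%N ->
    measurable_fun (unit_sphere R n) (r : _ -> measurableTypeR R) -> 0 < a ->
    (forall u, unit_sphere R n u -> a <= r u) ->
  (n%:R%:E * lebesgue_rV (star_set r) =
   \int[@sphere_measure R n]_(u in unit_sphere R n) (r u ^+ n)%:E)%E.
Proof.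
move=> n0 mr a0 ra.
                                                                               
                                                            
(* The limit q -> 1: to get x <= y it suffices that p x <= y for all p in (0,1), and q = p^(-1/n)
   satisfies q > 1 and p q^n = 1. *)
suff H q : 1 < q ->
    (n%:R%:E * lebesgue_rV (star_set r) <= (q ^+ n)%:E *
       \int[@sphere_measure R n]_(u in unit_sphere R n) (r u ^+ n)%:E)%E /\
    (\int[@sphere_measure R n]_(u in unit_sphere R n) (r u ^+ n)%:E <=
       (q ^+ n)%:E * (n%:R%:E * lebesgue_rV (star_set r)))%E.
  have r0 u : unit_sphere R n u -> (0 <= (r u ^+ n)%:E)%E.
    by move=> /ra h; rewrite lee_fin exprn_ge0// ltW// (lt_le_trans a0).
  have Q (p : R) : 0 < p < 1 -> 1 < p `^ (- n%:R^-1) /\ p * (p `^ (- n%:R^-1)) ^+ n = 1.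
    move=> /andP[p0 p1]; split.
      rewrite powRN invf_gt1 ?powR_gt0//.
      have : p `^ n%:R^-1 < 1 `^ n%:R^-1.
        by rewrite gt0_ltr_powR// ?invr_gt0 ?ltr0n// nnegrE ?ltW.
      by rewrite powR1.
    rewrite -powR_mulrn ?powR_ge0// -powRrM mulNr mulVf ?pnatr_eq0 -?lt0n//.
    by rewrite powRN powRr1 ?ltW// divff// gt_eqF.
  apply/le_anti/andP; split; apply/lee_mul01Pr.
  - by rewrite mule_ge0// lee_fin.
  - move=> p p01; have [/H[h _] pE] := Q _ p01; have /andP[p0 _] := p01.
    apply: (@le_trans _ _ (p%:E * ((p `^ (- n%:R^-1)) ^+ n)%:E * _)%E).
      rewrite -muleA; apply: lee_wpmul2l; [by rewrite lee_fin ltW|exact: h].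
    by rewrite -EFinM pE mul1e.
  - exact: integral_ge0.
  - move=> p p01; have [/H[_ h] pE] := Q _ p01; have /andP[p0 _] := p01.
    apply: (@le_trans _ _ (p%:E * ((p `^ (- n%:R^-1)) ^+ n)%:E * _)%E).
      rewrite -muleA; apply: lee_wpmul2l; [by rewrite lee_fin ltW|exact: h].
    by rewrite -EFinM pE mul1e.
move=> q1; pose e := q - 1; have e0 : 0 < e by rewrite subr_gt0.
(* The piece A k is where a(1 + k e) <= r < a(1 + (k+1) e). Since r >= a, g is nonnegative, so the
   pieces, indexed by the integer part of g, partition the sphere. *)
pose g u := (r u / a - 1) / e.
pose A (k : nat) := unit_sphere R n `&` g @^-1` `[k%:R, k.+1%:R[%classic.
have AE k u : A k u <-> unit_sphere R n u /\ Num.truncn (g u) = k.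
  split => [[Su]|[Su gk]].
    by rewrite /= in_itv/= => /truncn_def.
  have g0 : 0 <= g u.
    by rewrite divr_ge0 ?(ltW e0)// subr_ge0 ler_pdivlMr// mul1r ra.
  by split => //=; rewrite in_itv/= -gk; exact: truncn_itv.
have mg : measurable_fun (unit_sphere R n) (g : _ -> measurableTypeR R).
  apply: measurable_funM => //; apply: measurable_funB => //.
  exact: measurable_funM.
have mA k : measurable (A k).
  by apply: mg => //; exact: measurable_unit_sphere.
have AS : \bigcup_k A k = unit_sphere R n.
  apply/seteqP; split => [u [k _ []]//|u Su].
  by exists (Num.truncn (g u)) => //; apply/AE.
have tA : trivIset setT A.
  by move=> i j _ _ [u [/AE[_ <-] /AE[_ <-]]].
have dAS : \bigcup_k (star_set r `&` direction @^-1` A k) = star_set r.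
  apply/seteqP; split => [u [k _ []]//|x xr].
  have : unit_sphere R n (direction x) by apply: direction_sphere; case/andP: xr.
  by rewrite -AS => -[k _ Ak]; exists k.
have mdA k : measurable (star_set r `&` direction @^-1` A k).
  apply: measurableI; first exact: measurable_star_set.
  by rewrite -[X in measurable X]setTI; exact: measurable_direction.
have tdA : trivIset setT (fun k => star_set r `&` direction @^-1` A k).
  by move=> i j _ _ [u [[_ /AE[_ <-]] [_ /AE[_ <-]]]].
have XE : (n%:R%:E * lebesgue_rV (star_set r) = \sum_(k <oo)
    n%:R%:E * lebesgue_rV (star_set r `&` direction @^-1` A k))%E.
  rewrite nneseriesZl//; congr (_ * _)%E; rewrite -[in LHS]dAS.
  by rewrite measure_bigcup//; apply: eq_eseriesl => k; rewrite in_setT.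
have YE : (\int[@sphere_measure R n]_(u in unit_sphere R n) (r u ^+ n)%:E =
    \sum_(k <oo) \int[@sphere_measure R n]_(u in A k) (r u ^+ n)%:E)%E.
  rewrite -[in LHS]AS ge0_integral_bigcup//.
    by rewrite AS; apply/measurable_EFinP; exact: measurable_funX.
  by rewrite AS => u /ra h; rewrite lee_fin exprn_ge0// ltW// (lt_le_trans a0).
have XY k := star_set_direction_between r q (a * (1 + k%:R * e)) (A k) mr
  (ltW q1) ltac:(by rewrite mulr_gt0// ltr_wpDr// mulr_ge0// ltW) (mA k).
have {}XY k : (n%:R%:E * lebesgue_rV (star_set r `&` direction @^-1` A k) <=
     (q ^+ n)%:E * \int[@sphere_measure R n]_(u in A k) (r u ^+ n)%:E)%E /\
  (\int[@sphere_measure R n]_(u in A k) (r u ^+ n)%:E <=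
    (q ^+ n)%:E * (n%:R%:E * lebesgue_rV (star_set r `&` direction @^-1` A k)))%E.
  apply: XY => [u []//|u [Su]]; rewrite /= in_itv/= => /andP[].
  rewrite /g ler_pdivlMr// ltr_pdivrMr// => h1 h2.
  have rE : r u = a * (r u / a) by rewrite mulrC divfK// gt_eqF.
  rewrite rE (mulrCA q) !ler_pM2l//; apply/andP; split; first by lra.
  apply: (@le_trans _ _ (1 + k.+1%:R * e)); first by lra.
  have -> : q = 1 + e by rewrite /e; ring.
  (* The ratio of the bounds of r on A k is at most q, since (1 + e)(1 + k e) = 1 + (k+1) e + k
     e^2. *)
  have : 0 <= k%:R * e ^+ 2 by rewrite mulr_ge0// sqr_ge0.
  by rewrite -natr1; nra.
rewrite XE YE; split; rewrite -nneseriesZl.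
- by apply: lee_nneseries => k _; [rewrite mule_ge0// lee_fin|case: (XY k)].
- move=> k _; apply: integral_ge0 => u [/ra h _].
  by rewrite lee_fin exprn_ge0// ltW// (lt_le_trans a0).
- apply: lee_nneseries => k _; last by case: (XY k).
  move=> _; apply: integral_ge0 => u [/ra h _].
  by rewrite lee_fin exprn_ge0// ltW// (lt_le_trans a0).
- by move=> k _; rewrite mule_ge0// lee_fin.
Qed.

End polar_coordinates.

                                                   

(** * Convex functions on the positive half-line *)

Section convex_on_pos_theory.
Context {R : realType}.
Implicit Types (F : R -> R) (x y z a b t : R).

Lemma convex_on_posP F x y t : convex_on_pos F -> 0 < x -> 0 < y ->
  0 <= t <= 1 -> F (t * x + (1 - t) * y) <= t * F x + (1 - t) * F y.
Proof.
move=> cF x0 y0 /andP[t0 t1].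
have := cF (Itv01 t0 t1) x y; rewrite !inE => /(_ x0 y0).
by [].
Qed.

(** Three-point form of convexity, with denominators cleared so that the points may coincide. *)
Lemma convex_on_pos_chord F x y z : convex_on_pos F -> 0 < x -> x <= y <= z ->
  (z - x) * F y <= (z - y) * F x + (y - x) * F z.
Proof.
move=> cF x0 /andP[xy yz]; have [xz|zx] := ltP x z; last first.
  have -> : y = x by apply/le_anti; rewrite xy (le_trans yz zx).
  have -> : z = x by apply/le_anti; rewrite zx (le_trans xy yz).
  by rewrite !subrr !mul0r addr0.
have zx0 : 0 < z - x by rewrite subr_gt0.
pose t := (z - y) / (z - x).
have t01 : 0 <= t <= 1.
  apply/andP; split; first by rewrite divr_ge0 ?subr_ge0// ltW.
  by rewrite ler_pdivrMr// mul1r lerB.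
have yE : y = t * x + (1 - t) * z by rewrite /t; field; lra.
have := convex_on_posP F x z t cF x0 (lt_trans x0 xz) t01.
rewrite -yE -(ler_pM2l zx0) => /le_trans; apply.
by rewrite le_eqVlt /t; apply/orP; left; apply/eqP; field; lra.
Qed.

Lemma convex_on_pos_support F y : convex_on_pos F -> 0 < y ->
  exists c, forall x, 0 < x -> F y + c * (x - y) <= F x.
Proof.
move=> cF y0.
(* The slope is the supremum of the slopes of chords ending at y from the left; by convexity each
   chord slope to the right of y is an upper bound of them. *)
pose S := [set (F y - F x) / (y - x) | x in [set x | 0 < x < y]].
have S0 : S !=set0 by exists ((F y - F (y / 2)) / (y - y / 2)), (y / 2) => //=; lra.
have ubS z : y < z -> ubound S ((F z - F y) / (z - y)).
  move=> yz _ [x /andP[x0 xy] <-].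
  rewrite ler_pdivrMr ?subr_gt0// mulrAC ler_pdivlMr ?subr_gt0//.
  have xyz : x <= y <= z by rewrite !ltW.
  have := convex_on_pos_chord F x y z cF x0 xyz; nra.
have hS : has_sup S by split=> //; exists ((F (y + 1) - F y) / (y + 1 - y)); apply: ubS; lra.
exists (sup S) => x x0; have [xy|yx|->] := ltgtP x y; last by rewrite subrr mulr0 addr0.
- have : (F y - F x) / (y - x) <= sup S.
    by apply: ub_le_sup; [exact: hS.2|exists x => //=; rewrite x0].
  by rewrite ler_pdivrMr ?subr_gt0//; nra.
- have : sup S <= (F x - F y) / (x - y) by apply: ge_sup => //; exact: ubS.
  by rewrite ler_pdivlMr ?subr_gt0//; nra.
Qed.

(** If the line met the graph again at x, strict convexity would put F below the line at the
    midpoint of x and y. *)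
Lemma strictly_convex_on_pos_support F y c : strictly_convex_on_pos F -> 0 < y ->
  (forall x, 0 < x -> F y + c * (x - y) <= F x) ->
  forall x, 0 < x -> x != y -> F y + c * (x - y) < F x.
Proof.
move=> sF y0 cF x x0 xy.
have h01 : 0 < (2^-1 : R) < 1 by lra.
have := sF 2^-1 x y h01 x0 y0 xy.
have : 0 < 2^-1 * x + (1 - 2^-1) * y by lra.
by move=> /cF; lra.
Qed.

Lemma convex_on_pos_le_max F a b x : convex_on_pos F -> 0 < a -> a <= x <= b ->
  F x <= Num.max (F a) (F b).
Proof.
move=> cF a0 /andP[ax xb]; have [ab|ba] := ltP a b; last first.
  have -> : x = a by apply/le_anti; rewrite ax (le_trans xb ba).
  by rewrite le_max lexx.
have := convex_on_pos_chord F a x b cF a0; rewrite ax xb => /(_ isT) h.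
rewrite -(@ler_pM2l _ (b - a)) ?subr_gt0//; apply: (le_trans h).
set M := Num.max _ _.
have Fa : F a <= M by rewrite le_max lexx.
have Fb : F b <= M by rewrite le_max lexx orbT.
nra.
Qed.

(** From above by the larger endpoint value, from below by a supporting line at a. *)
Lemma convex_on_pos_bounded F a b : convex_on_pos F -> 0 < a ->
  exists M, forall x, a <= x <= b -> `|F x| <= M.
Proof.
move=> cF a0; have [c hc] := convex_on_pos_support F a cF a0.
exists (`|F a| + `|F b| + `|c| * `|b - a|) => x /andP[ax xb].
have := convex_on_pos_le_max F a b x cF a0; rewrite ax xb => /(_ isT).
rewrite le_max => hle.
have := hc x (lt_le_trans a0 ax); have cp := normr_ge0 c.
have := ler_norm (F a); have := ler_norm (F b); have := ler_norm (- F a).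
have := ler_norm (- F b); have := ler_norm (-c); have := ler_norm c.
rewrite !normrN [`|b - a|]ger0_norm ?subr_ge0 ?(le_trans ax)//.
move=> c1 c2 b1 a1 b2 a2 h.
have hm : 0 <= `|c| * (b - a) by rewrite mulr_ge0// subr_ge0 (le_trans ax).
have hm2 : - (`|c| * (b - a)) <= c * (x - a) by nra.
by rewrite ler_norml; apply/andP; split; [|case/orP: hle]; lra.
Qed.

(** The strict sublevel sets are intervals, by [convex_on_pos_le_max]. *)
Lemma convex_on_pos_measurable F : convex_on_pos F ->
  measurable_fun (pos_line : set (measurableTypeR R)) (F : _ -> measurableTypeR R).
Proof.
move=> cF mD; apply: (measurability _ (RGenInftyO.measurableE R)) => //.
                                                       
move=> _ [_ [r ->] <-]; apply: is_interval_measurable => s t /=.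
rewrite !in_itv/= => -[s0 Fs] [t0 Ft] u /andP[su ut].
split; first exact: lt_le_trans su.
have := convex_on_pos_le_max F s t u cF s0; rewrite su ut => /(_ isT).
by rewrite in_itv/= le_max => /orP[] /le_lt_trans; apply.
Qed.

End convex_on_pos_theory.

                    

(** * Star bodies and the spherical measure *)

Section star_bodies.
Context {R : realType} {n : nat} (n_gt0 : (0 < n)%N).
Implicit Types (K : set 'rV[R]_n) (r : R) (u x : 'rV[R]_n).
Local Notation S := (unit_sphere R n).
Local Notation sigma := (@sphere_measure R n).

Lemma lebesgue_rV_setU0 (A : set 'rV[R]_n) : measurable A ->
  lebesgue_rV (A `|` [set 0]) = lebesgue_rV A.
Proof.
move=> mA; apply: measureU0 => //; last exact: lebesgue_rV_origin.
rewrite (_ : [set 0] = enorm @^-1` [set 0]); last first.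
  apply/seteqP; split => [_ ->|x /= x0]; first exact: enorm0.
  by apply/eqP; rewrite -[_ == _]negbK -enorm_gt0 x0 ltxx.
by rewrite -[X in measurable X]setTI; exact: measurable_enorm.
Qed.

Lemma unit_ballE : unit_ball R n = star_set (cst 1) `|` [set 0].
Proof.
apply/seteqP; split => [x|x]; rewrite /unit_ball /star_set/=.
  by have [->|x0 ->] := eqVneq x 0; [right|left; rewrite enorm_gt0 x0].
by move=> [/andP[]//|->]; rewrite enorm0.
Qed.

(** The cone over the whole sphere is the punctured unit ball. Hence the prefactor in
    [orlicz_radius] normalizes the spherical measure to total mass 1. *)
Lemma sphere_measure_sphere :
  sphere_measure S = (n%:R * fine (lebesgue_rV (unit_ball R n)))%:E.
Proof.
rewrite EFinM fineK; last first.
  by rewrite ge0_fin_numE ?lebesgue_unit_ball_lty.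
rewrite unit_ballE lebesgue_rV_setU0; last first.
  by apply: measurable_star_set; exact: measurable_cst.
rewrite /sphere_measure sphere_coneE; congr (_ * lebesgue_rV _)%E.
by apply/seteqP; split => [x []//|x xs]; split => //; apply: direction_sphere; case/andP: xs.
Qed.

Lemma sphere_measure_sphere_gt0 : 0 < n%:R * fine (lebesgue_rV (unit_ball R n)).
Proof.
by rewrite mulr_gt0 ?ltr0n// fine_gt0// lebesgue_unit_ball_gt0 lebesgue_unit_ball_lty.
Qed.

Lemma scaled_unit_ball r : 0 < r ->
  [set r *: x | x in unit_ball R n] = [set x | enorm x <= r].
Proof.
move=> r0; apply/seteqP; split => [_ [x x1 <-]|x xr] /=.
  by rewrite enormZ gtr0_norm// ger_pMr.
exists (r^-1 *: x); last by rewrite scalerA divff ?scale1r// gt_eqF.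
by rewrite /unit_ball/= enormZ gtr0_norm ?invr_gt0// ler_pdivrMl// mulr1.
Qed.

Lemma lebesgue_ball r : 0 < r ->
  lebesgue_rV [set x : 'rV[R]_n | enorm x <= r] =
  ((r ^+ n)%:E * lebesgue_rV (unit_ball R n))%E.
Proof.
move=> r0; rewrite -(lebesgue_rV_preimageZ n r)//.
  congr (_ * lebesgue_rV _)%E; apply/seteqP; split => x;
  by rewrite /unit_ball/= enormZ gtr0_norm// ger_pMr.
rewrite (_ : [set x | _] = enorm @^-1` `]-oo, r]%classic); last first.
  by apply/seteqP; split => x /=; rewrite in_itv.
by rewrite -[X in measurable X]setTI; exact: measurable_enorm.
Qed.

Lemma radial_ball r u : 0 < r -> S u -> radial [set x | enorm x <= r] u = r.
Proof.
move=> r0 u1; rewrite /radial.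
have -> : [set l | [set x | enorm x <= r] (l *: u)] = [set l | `|l| <= r].
  by apply/seteqP; split => l /=; rewrite enormZ u1 mulr1.
apply/le_anti/andP; split.
  apply: ge_sup; first by exists 0; rewrite /= normr0 ltW.
  by move=> l /= /(le_trans (ler_norm _)).
apply: ub_le_sup; last by rewrite /= gtr0_norm.
by exists r => l /= /(le_trans (ler_norm _)).
Qed.

Lemma star_bodyE K : star_body K -> K = star_set (radial K) `|` [set 0].
Proof.
move=> [scK maxK _ posK]; apply/seteqP; split => [x Kx|x].
  have [->|x0] := eqVneq x 0; first by right.
  left; rewrite -enorm_gt0 in x0; rewrite /star_set/= x0/=.
  have [_] := maxK _ (direction_sphere _ x0); apply.
  by rewrite enorm_direction.
case=> [/andP[x0 xr]|->].
  have Sx := direction_sphere _ x0; have [Kr _] := maxK _ Sx.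
  have r0 := posK _ Sx.
  rewrite -(enorm_direction x) -(divfK (lt0r_neq0 r0) (enorm x)) -scalerA.
  by apply: scK => //; rewrite divr_ge0 ?enorm_ge0 ?(ltW r0)//= ler_pdivrMr// mul1r.
(* The origin is in K as the endpoint of a segment, which needs some point of the sphere, hence n >
   0. *)
have [u Su] := @unit_sphere_neq0 R n n_gt0.
have [Kr _] := maxK _ Su.
by rewrite -[0](scale0r (radial K u *: u)); apply: scK => //; rewrite lexx ler01.
Qed.

(** The bounds are the minimum and maximum of a continuous positive function on the compact
    sphere. *)
Lemma radial_bounded K : star_body K ->
  exists2 ab, 0 < ab.1 & forall u, S u -> ab.1 <= radial K u <= ab.2.
Proof.
move=> [_ _ cK posK]; have S0 := @unit_sphere_neq0 R n n_gt0.
have [u] := compact_EVT_min S0 unit_sphere_compact cK.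
have [v] := compact_EVT_max S0 unit_sphere_compact cK.
move=> _ hv uS hu; exists (radial K u, radial K v) => /=.
  by apply: posK; exact/set_mem.
by move=> x Sx; rewrite hu ?hv// inE.
Qed.

Lemma lebesgue_star_body K : star_body K ->
  (n%:R%:E * lebesgue_rV K =
   \int[sigma]_(u in S) (radial K u ^+ n)%:E)%E.
Proof.
move=> sK; have [[a b] /= a0 ab] := radial_bounded K sK.
have mr : measurable_fun S (radial K : _ -> measurableTypeR R).
  by apply: sphere_continuous_measurable; case: sK.
rewrite [in LHS](star_bodyE K sK) lebesgue_rV_setU0; last exact: measurable_star_set.
by apply: (polar_volume _ a) => // u /ab/andP[].
Qed.

Lemma sphere_bounded_integrable (f : 'rV[R]_n -> R) M :
  measurable_fun S (f : _ -> measurableTypeR R) ->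
  (forall u, S u -> `|f u| <= M) -> sigma.-integrable S (EFin \o f).
Proof.
move=> mf fM; apply: measurable_bounded_integrable => //.
- exact: measurable_unit_sphere.
- by rewrite [ltLHS]sphere_measure_sphere ltry.
- exists M; split => [|y My u Su]; first exact: num_real.
  exact: le_trans (fM u Su) (ltW My).
Qed.

(** The substitution t = rho^n, which replaces phi by the function whose convexity is assumed and
    rho by the quantity whose integral is a volume. *)
Lemma substF_radial (phi : R -> R) K u : star_body K -> S u ->
  phi (radial K u)^-1 = substF n phi (radial K u ^+ n).
Proof.
move=> [_ _ _ posK] /posK r0; rewrite /substF -powR_mulrn ?ltW// -powRrM.
by rewrite mulrN divff ?pnatr_eq0 -?lt0n// powRN powRr1 ?ltW.
Qed.

                                                                            
                                                   
(** If f differs from r at u0, it does so on a relative neighbourhood of u0. The cone over it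
    contains a nonempty open set, so it has positive volume and the neighbourhood positive spherical
    measure. *)
Lemma eq_on_sphere_of_negligible (f : 'rV[R]_n -> R) r :
  {within S, continuous f} ->
  sigma.-negligible (S `&` [set u | f u != r]) -> forall u, S u -> f u = r.
Proof.
move=> cf [N [mN N0 fN]] u0 Su0; apply: contrapT => /eqP fr.
pose V := [set x : 'rV[R]_n | [/\ 0 < enorm x, enorm x < 1 & f (direction x) != r]].
have u0e : enorm u0 = 1 := Su0.
have u02 : enorm (2^-1 *: u0) = 2^-1.
  by rewrite enormZ u0e mulr1 gtr0_norm ?invr_gt0.
have d0 : direction (2^-1 *: u0) = u0 by rewrite directionZ ?invr_gt0 ?direction_id.
(* The midpoint of the segment from 0 to u0 avoids both the origin and the sphere, so all three
   conditions defining V persist near it. *)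
have nV : V° (2^-1 *: u0).
  have n1 : \forall x \near 2^-1 *: u0, 0 < enorm x.
    apply: (@enorm_continuous R n (2^-1 *: u0) [set y | 0 < y]).
    by rewrite u02; apply: lt_nbhsr; rewrite invr_gt0.
  have n2 : \forall x \near 2^-1 *: u0, enorm x < 1.
    apply: (@enorm_continuous R n (2^-1 *: u0) [set y | y < 1]).
    by rewrite u02; apply: lt_nbhsl; rewrite invf_lt1 ?ltr1n.
  (* Continuity of f is only relative to the sphere; composing with [direction] gives a
     neighbourhood in R^n. *)
  have n3 : \forall x \near 2^-1 *: u0, S (direction x) -> f (direction x) != r.
    have dc : {for 2^-1 *: u0, continuous (@direction R n)}.
      by apply: direction_continuous; rewrite -enorm_gt0 u02 invr_gt0.
    apply: (dc [set u | S u -> f u != r]); rewrite d0.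
    have nr : nbhs (f u0) [set y | y != r].
      by apply: open_nbhs_nbhs; split => //; exact: open_neq.
    have : @nbhs_subspace _ S u0 (f @^-1` [set y | y != r]) := cf u0 _ nr.
    by rewrite -nbhs_subspace_in.
  apply: filterS3 n1 n2 n3 => x x0 x1 xr; split => //.
  by apply: xr; exact: direction_sphere.
have mc : measurable (sphere_cone N).
  rewrite sphere_coneE; apply: measurableI.
    by apply: measurable_star_set; exact: measurable_cst.
  by rewrite -[X in measurable X]setTI; exact: measurable_direction.
have : (0 < lebesgue_rV (sphere_cone N))%E.
  apply: (@lt_le_trans _ _ (lebesgue_rV V°)).
    by apply: (@open_lebesgue_rV_gt0 R n _ (2^-1 *: u0)) => //; exact: open_interior.
  apply: le_measure; rewrite ?inE//.
    by apply: open_rV_measurable; exact: open_interior.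
  move=> x /interior_subset[x0 x1 xr]; rewrite sphere_coneE; split.
    by rewrite /star_set/= x0 ltW.
  by apply: fN; split => //; exact: direction_sphere.
move: N0; rewrite /= /sphere_measure => /eqP; rewrite mule_eq0 eqe pnatr_eq0.
by rewrite (gtn_eqF n_gt0)/= => /eqP ->; rewrite ltxx.
Qed.

End star_bodies.

                                                  

(** * Jensen's inequality and its equality case for the radial function *)

Section orlicz_jensen.
Context {R : realType} {n : nat} (n_gt0 : (0 < n)%N).
Context (K : set 'rV[R]_n) (r : R) (sK : star_body K) (r0 : 0 < r).
Context (volK : lebesgue_rV [set x : 'rV[R]_n | enorm x <= r] = lebesgue_rV K).
Implicit Types (phi F : R -> R).
Local Notation S := (unit_sphere R n).
Local Notation sigma := (@sphere_measure R n).
Local Notation rho := (radial K).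
Local Notation w := (n%:R * fine (lebesgue_rV (unit_ball R n))).

Lemma measurable_radialX :
  measurable_fun S (fun u => rho u ^+ n : measurableTypeR R).
Proof.
apply: measurable_funX; apply: sphere_continuous_measurable.
by case: sK.
Qed.

Lemma integrable_radialX : sigma.-integrable S (fun u => (rho u ^+ n)%:E).
Proof.
have [[a b] /= a0 ab] := radial_bounded n_gt0 K sK.
apply: (sphere_bounded_integrable n_gt0 _ (b ^+ n)); first exact: measurable_radialX.
move=> u /ab/andP[au ub]; have u0 := lt_le_trans a0 au.
rewrite ger0_norm; last by rewrite exprn_ge0// ltW.
by rewrite lerXn2r// nnegrE ltW// (lt_le_trans u0).
Qed.

(** The values of rho^n stay in a compact interval of positive numbers, where F is bounded. *)
Lemma integrable_convex_radialX F : convex_on_pos F ->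
  sigma.-integrable S (fun u => (F (rho u ^+ n))%:E).
Proof.
move=> cF; have [[a b] /= a0 ab] := radial_bounded n_gt0 K sK.
have [M FM] := convex_on_pos_bounded F (a ^+ n) (b ^+ n) cF (exprn_gt0 n a0).
apply: (sphere_bounded_integrable n_gt0 _ M).
  have mp : measurable (pos_line : set (measurableTypeR R)).
    rewrite (_ : pos_line = `]0, +oo[%classic) ?measurable_itv//.
    by apply/seteqP; split => x; rewrite /pos_line/= in_itv/= andbT.
  apply: (measurable_comp mp _ (convex_on_pos_measurable F cF) measurable_radialX).
  by move=> _ [u Su <-]; apply: exprn_gt0; case: sK => _ _ _; exact.
move=> u /ab/andP[au ub]; have u0 := lt_le_trans a0 au; apply: FM.
have b0 := lt_le_trans u0 ub.
by rewrite !lerXn2r// nnegrE ltW.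
Qed.

(** The place where equality of volumes enters: rho^n has mean r^n. *)
Lemma Rintegral_radialX : \int[sigma]_(u in S) (rho u ^+ n) = w * r ^+ n.
Proof.
rewrite /Rintegral -lebesgue_star_body// -volK lebesgue_ball//.
rewrite muleCA mulrC -[X in (_ * (_ * X))%E]fineK//.
by rewrite ge0_fin_numE ?lebesgue_unit_ball_lty.
Qed.

Lemma Rintegral_sphere_cst k : \int[sigma]_(u in S) k = k * w.
Proof.
rewrite Rintegral_cst; last exact: measurable_unit_sphere.
congr (_ * _); rewrite -[RHS]/(fine w%:E); congr fine.
exact: sphere_measure_sphere.
Qed.

Lemma orlicz_radius_substF phi :
  orlicz_radius phi K = w^-1 * \int[sigma]_(u in S) substF n phi (rho u ^+ n).
Proof.
congr (_ * _); apply: eq_Rintegral => u /set_mem Su.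
exact: substF_radial.
Qed.

Lemma orlicz_radius_ball phi :
  orlicz_radius phi [set x : 'rV[R]_n | enorm x <= r] = substF n phi (r ^+ n).
Proof.
rewrite /orlicz_radius (@eq_Rintegral _ _ _ _ _ (fun=> phi r^-1)); last first.
  by move=> u /set_mem Su; rewrite radial_ball.
rewrite Rintegral_sphere_cst.
rewrite mulrCA mulVf ?mulr1 ?gt_eqF ?sphere_measure_sphere_gt0//.
rewrite /substF -powR_mulrn ?ltW// -powRrM.
by rewrite mulrN divff ?pnatr_eq0 -?lt0n// powRN powRr1 ?ltW.
Qed.

                                                                              
                                                                      
(** Here c is arbitrary: since rho^n has mean s, the linear term integrates to 0, and F(s) is the
    Orlicz radius of the ball. *)
Lemma orlicz_radius_gap phi c : convex_on_pos (substF n phi) ->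
  let F := substF n phi in
  let s := r ^+ n in
  let g u := F (rho u ^+ n) - (F s + c * (rho u ^+ n - s)) in
  sigma.-integrable S (EFin \o g) /\
  \int[sigma]_(u in S) g u =
  w * (orlicz_radius phi K - orlicz_radius phi [set x : 'rV[R]_n | enorm x <= r]).
Proof.
move=> cF F s g.
have mS := @measurable_unit_sphere R n.
have iF := integrable_convex_radialX F cF.
have iR := integrable_radialX.
have iC k : sigma.-integrable S (EFin \o cst k).
  by apply: (sphere_bounded_integrable n_gt0 _ `|k|) => //; exact: measurable_cst.
have iRs : sigma.-integrable S (EFin \o (fun u => rho u ^+ n - s)).
  exact: integrableB iR (iC s).
have icR : sigma.-integrable S (EFin \o (fun u => c * (rho u ^+ n - s))).
  exact: integrableZl iRs.
have iL : sigma.-integrable S (EFin \o (fun u => F s + c * (rho u ^+ n - s))).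
  exact: integrableD (iC (F s)) icR.
split; first exact: integrableB iF iL.
rewrite RintegralB// RintegralD// ?RintegralZl// ?RintegralB//; try exact: (iC _).
rewrite Rintegral_radialX !Rintegral_sphere_cst.
have w0 := sphere_measure_sphere_gt0 n_gt0 (R := R).
rewrite orlicz_radius_substF orlicz_radius_ball -/F -/s.
by move: w0; set W := w => w0; field; rewrite gt_eqF.
Qed.

Lemma orlicz_radius_convex_ge phi : convex_on_pos (substF n phi) ->
  orlicz_radius phi [set x : 'rV[R]_n | enorm x <= r] <= orlicz_radius phi K.
Proof.
move=> cF; have [c hc] := convex_on_pos_support _ (r ^+ n) cF (exprn_gt0 n r0).
have [_ gE] := orlicz_radius_gap phi c cF.
rewrite -subr_ge0 -(pmulr_rge0 _ (sphere_measure_sphere_gt0 n_gt0 (R := R))) -gE.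
apply: Rintegral_ge0 => u Su; rewrite subr_ge0; apply: hc.
by apply: exprn_gt0; case: sK => _ _ _; exact.
Qed.

(** Equality makes the nonnegative gap g integrate to 0, so it vanishes almost everywhere; the
    supporting line touches only at r^n, which forces rho = r there, and continuity of rho does the
    rest. *)
Lemma orlicz_radius_strictly_convex_eq phi : convex_on_pos (substF n phi) ->
  strictly_convex_on_pos (substF n phi) ->
  orlicz_radius phi K = orlicz_radius phi [set x : 'rV[R]_n | enorm x <= r] ->
  K = [set x | enorm x <= r].
Proof.
move=> cF sF E; have rn0 := exprn_gt0 n r0.
have [c hc] := convex_on_pos_support _ (r ^+ n) cF rn0.
have hs := strictly_convex_on_pos_support _ _ _ sF rn0 hc.
have [ig gE] := orlicz_radius_gap phi c cF.
rewrite E subrr mulr0 in gE.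
set g := fun u => _ in ig gE.
have rho0 u : S u -> 0 < rho u by case: sK => _ _ _; exact.
have g0 u : S u -> 0 <= g u.
  by move=> Su; rewrite subr_ge0; apply: hc; exact/exprn_gt0/rho0.
have mS := @measurable_unit_sphere R n.
have : (\int[sigma]_(u in S) `|(EFin \o g) u| = 0)%E.
  rewrite (eq_integral (EFin \o g)); last first.
    by move=> u /set_mem /g0 gu; rewrite /= ger0_norm.
  by rewrite -[LHS]fineK; [rewrite -[fine _]/(Rintegral _ _ _) gE|exact: integrable_fin_num].
move/(ae_eq_integral_abs _ mS (measurable_int _ ig)) => ae.
have rhoE : forall u, S u -> rho u = r.
  apply: eq_on_sphere_of_negligible => //; first by case: sK.
  (* Where rho differs from r, the powers differ too, so the strict support inequality excludes g =
     0. *)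
  apply: negligibleS ae => u [Su /= ur] /(_ Su)/= [] /eqP.
  rewrite /g subr_eq0 => /eqP gu.
  have := hs (rho u ^+ n) (exprn_gt0 n (rho0 u Su)).
  rewrite gu ltxx eqrXn2 ?ltW ?rho0// => /(_ ur).
  by [].
rewrite (star_bodyE n_gt0 K sK); apply/seteqP; split => [x|x /= xr].
  case=> [/andP[x0]|->] /=; last by rewrite enorm0 ltW.
  by rewrite rhoE//; exact: direction_sphere.
have [->|x0] := eqVneq x 0; [by right|left].
by rewrite /star_set/= enorm_gt0 x0 rhoE//; apply: direction_sphere; rewrite enorm_gt0.
Qed.

(** Carries the concave case back to the convex one. Linearity is applied to the integral of -F,
    whose integrability follows from its convexity. *)
Lemma orlicz_radiusN phi : convex_on_pos (\- substF n phi) ->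
  orlicz_radius (\- phi) K = - orlicz_radius phi K.
Proof.
move=> cF; rewrite !orlicz_radius_substF -mulrN; congr (_ * _).
have := @RintegralZl _ _ _ sigma S _ (-1) (@measurable_unit_sphere R n)
  (integrable_convex_radialX _ cF).
rewrite mulN1r => /(congr1 -%R); rewrite opprK => <-; congr (- _).
by apply: eq_Rintegral => u _; rewrite mulN1r opprK.
Qed.

End orlicz_jensen.

(** Absorbs the constant alternative of both function classes into the convex case. *)
Lemma cst_convex_on_pos (R : realType) (F : R -> R) c :
  (forall t, 0 < t -> F t = c) -> convex_on_pos F.
Proof.
move=> Fc t x y; rewrite !inE => x0 y0.
have := convR_gt0 t x0 y0 => h; rewrite !Fc//.
by rewrite (@convmm _ R^o).
Qed.

Lemma lebesgue_ball_inj (R : realType) (n : nat) (r s : R) : (0 < n)%N ->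
    0 < r -> 0 < s ->
    lebesgue_rV [set x : 'rV[R]_n | enorm x <= r] =
    lebesgue_rV [set x : 'rV[R]_n | enorm x <= s] -> r = s.
Proof.
move=> n0 r0 s0; rewrite (lebesgue_ball r r0) (lebesgue_ball s s0) => /(congr1 fine).
have w0 := @lebesgue_unit_ball_gt0 R n; have wy := @lebesgue_unit_ball_lty R n.
have wf : lebesgue_rV (unit_ball R n) \is a fin_num by rewrite ge0_fin_numE.
rewrite !fineM//= => /mulIf; rewrite gt_eqF ?fine_gt0 ?w0// => /(_ isT)/eqP.
by rewrite eqrXn2 ?ltW// => /eqP.
Qed.

Theorem theorem4p3 (R : realType) (n : nat) (n_gt0 : (0 < n)%N)
    (K B_K : set 'rV[R]_n) (K_star : star_body K) (B_K_ball : origin_ball B_K)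
    (vol_B_K : lebesgue_rV B_K = lebesgue_rV K) (phi : R -> R) :
  (class_Phi n phi ->
     orlicz_radius phi B_K <= orlicz_radius phi K /\
     (strictly_convex_on_pos (substF n phi) ->
        (orlicz_radius phi K = orlicz_radius phi B_K <-> origin_ball K))) /\
  (class_Psi n phi ->
     orlicz_radius phi K <= orlicz_radius phi B_K /\
     (strictly_concave_on_pos (substF n phi) ->
        (orlicz_radius phi K = orlicz_radius phi B_K <-> origin_ball K))).
Proof.
case: B_K_ball => r r0 BE; rewrite scaled_unit_ball// in BE.
rewrite {}BE in vol_B_K *; set B := [set x | _].
(* The volume of a ball determines its radius, so being some ball and being B amount to the same for
   K. *)
have ball_eq : origin_ball K -> K = B.
  move=> [s s0]; rewrite scaled_unit_ball// => KE; rewrite KE in vol_B_K *.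
  by rewrite /B (lebesgue_ball_inj R n r s n_gt0 r0 s0 vol_B_K).
have ball_B : K = B -> origin_ball K.
  by move=> ->; exists r => //; rewrite scaled_unit_ball.
have H psi := orlicz_radius_convex_ge n_gt0 K r K_star r0 vol_B_K psi.
have Heq psi := orlicz_radius_strictly_convex_eq n_gt0 K r K_star r0 vol_B_K psi.
split => [[_ phiP]|[_ phiP]].
  have cF : convex_on_pos (substF n phi).
    by case: phiP => [[c /cst_convex_on_pos]|].
  split; first exact: H.
  move=> sF; split => [E|/ball_eq -> //]; exact/ball_B/(Heq phi).
have cF : convex_on_pos (\- substF n phi).
  case: phiP => [[c Fc]|[]//]; apply: (@cst_convex_on_pos _ _ (- c)) => t t0.
  by rewrite /= Fc.
have KN := orlicz_radiusN n_gt0 K K_star phi cF.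
have BN : orlicz_radius (\- phi) B = - orlicz_radius phi B.
  by rewrite !(orlicz_radius_ball n_gt0).
(* [substF n (\- phi)] is convertible to [\- substF n phi], so the convex results apply to [\- phi]
   directly. *)
split; first by rewrite -lerN2 -KN -BN; exact: H.
move=> sF; split => [E|/ball_eq -> //].
by apply/ball_B/(Heq (\- phi)) => //; rewrite KN BN E.
Qed.
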